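(* Let $k,d,\lambda$ be positive integers with $d\ge\lambda$ and $k\ge\lambda+1$, and suppose $\alpha(d,\lambda)<1$. Then $$(d-\lambda+1)+k\le m^*(k,d,\lambda).$$
   Context: For a finite set $X\subset\mathbb{R}^d$, a $(d-\lambda)$-plane (affine subspace of dimension $d-\lambda$) $L$ is a Kneser transversal of $X$ if $L$ intersects $\operatorname{conv}(K)$ for every $k$-element subset $K$ of $X$; it is a complete Kneser $(d-\lambda)$-transversal if in addition $L$ contains $d-\lambda+1$ points of $X$. $m^*(k,d,\lambda)$ denotes the maximum positive integer $n$ such that every set of $n$ points (not necessarily in general position) in $\mathbb{R}^d$ has a complete Kneser $(d-\lambda)$-transversal to the convex hulls of its $k$-element subsets. $\alpha(d,\lambda)=\frac{\lambda-1}{\lceil d/2\rceil}$. *)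

(* Defs.v *)
From mathcomp Require Import all_boot all_order all_algebra finmap.
From mathcomp Require Import all_classical all_reals all_analysis.

Set Implicit Arguments.
Unset Strict Implicit.
Unset Printing Implicit Defensive.

Import Order.TTheory GRing.Theory Num.Theory.

Local Open Scope classical_set_scope.
Local Open Scope fset_scope.
Local Open Scope ring_scope.

Definition convex_hull (R : realType) (d : nat) (A : set 'rV[R]_d) :
    set 'rV[R]_d :=
  smallest (@convex_set R 'rV[R]_d) A.

Definition affine_plane (R : realType) (d r : nat) (L : set 'rV[R]_d) : Prop :=
  exists (p : 'rV[R]_d) (U : {vspace 'rV[R]_d}),
    \dim U = r /\ L = [set x | x - p \in U].

Definition kneser_transversal (R : realType) (d k r : nat)
    (X : {fset 'rV[R]_d}) (L : set 'rV[R]_d) : Prop :=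
  affine_plane r L /\
  forall K : {fset 'rV[R]_d}, K `<=` X -> #|` K| = k ->
    (L `&` convex_hull [set` K] !=set0)%classic.

(* [L] may contain further points of [X] when [X] is not in general position,
   so containing r + 1 points means containing at least r + 1 of them. *)
Definition complete_kneser_transversal (R : realType) (d k r : nat)
    (X : {fset 'rV[R]_d}) (L : set 'rV[R]_d) : Prop :=
  kneser_transversal k r X L /\
  exists Y : {fset 'rV[R]_d},
    [/\ Y `<=` X, #|` Y| = r.+1 & ([set` Y] `<=` L)%classic].

Definition always_complete_transversal (R : realType) (k d lambda : nat) :
    set nat :=
  [set n | (0 < n)%N /\
    forall X : {fset 'rV[R]_d}, #|` X| = n ->
      exists L, complete_kneser_transversal k (d - lambda) X L]%classic.

(* The maximum of the set above. The default 0 is returned when there is no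
   maximum (set empty or unbounded), so a positive lower bound on [mstar]
   entails that the maximum exists. *)
Definition mstar (R : realType) (k d lambda : nat) : nat :=
  let S := always_complete_transversal R k d lambda in
  xget 0%N (S `&` ubound S)%classic.

(* [uphalf d] is the ceiling of d / 2. *)
Definition alpha (d lambda : nat) : rat :=
  (lambda%:R - 1) / (uphalf d)%:R.

(* Main.v *)
Require Import Defs.
From mathcomp Require Import all_boot all_order all_algebra.
From mathcomp Require Import all_classical all_reals all_analysis.
From mathcomp Require Import finmap zify.

Set Implicit Arguments.
Unset Strict Implicit.
Unset Printing Implicit Defensive.

Import Order.TTheory GRing.Theory Num.Theory.

Local Open Scope fset_scope.
Local Open Scope ring_scope.

(** Put r = d - lambda and let X have r + 1 + k >= d + 2 points.  Any d + 2 of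
    them carry a nontrivial affine dependence c; up to sign, c is positive on
    at most floor(d/2) + 1 <= r + 1 points, by the hypothesis on alpha.  Take Y
    in X with r + 1 points containing all of these and missing some b with
    c b < 0, and an r-plane L through Y.  A k-subset of X either meets Y or is
    X \ Y; in the latter case c is nonpositive and nonzero on X \ Y, so moving
    the terms of X \ Y to the other side of the dependence yields a point of
    conv (X \ Y) lying in aff Y.
    The maximum exists because a hyperplane meets n > d + 2k points of the
    moment curve in at most d of them, hence leaves k of the others strictly on
    one side, and their hull misses every plane inside that hyperplane. *)

(** * Convex hulls and weighted barycenters *)

Lemma sub_convex_hull (R : realType) (d : nat) (A : set 'rV[R]_d) x :
  A x -> convex_hull A x.
Proof. by move=> Ax B [_]; apply. Qed.

Lemma convex_hull_subset (R : realType) (d : nat) (A B : set 'rV[R]_d) :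
  convex_set (B : set (convex_lmodType 'rV[R]_d)) ->
  (A `<=` B)%classic -> (convex_hull A `<=` B)%classic.
Proof. by move=> cB AB x; apply. Qed.

Lemma convex_setE (R : realType) (M : lmodType R)
    (A : set (convex_lmodType M)) :
  convex_set A <-> forall (x y : M) (t : R), 0 <= t <= 1 -> A x -> A y ->
    A (t *: x + (1 - t) *: y).
Proof.
split=> [cA x y t t01 Ax Ay|cA x y t].
  have t01' : Itv.spec (Itv.num_sem (R:=R)) (Itv.Real `[0%Z, 1%Z]) t.
    by apply/andP; split; rewrite ?ger0_real ?in_itv//=; case/andP: t01.
  exact: set_mem (cA x y (Itv.mk t01') (mem_set Ax) (mem_set Ay)).
move=> /set_mem Ax /set_mem Ay; apply: mem_set.
by apply: cA; rewrite ?ge0 ?le1.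
Qed.

(** Induction on [s]. Dividing by the total weight, instead of asking for weights of sum 1, lets the
    induction hypothesis apply directly to the tail. *)
Lemma convex_barycenter (R : realType) (M : lmodType R)
    (A : set (convex_lmodType M)) (s : seq M) (c : M -> R) :
  convex_set A -> (forall x, x \in s -> A x) ->
  (forall x, x \in s -> 0 <= c x) -> 0 < \sum_(x <- s) c x ->
  A ((\sum_(x <- s) c x)^-1 *: \sum_(x <- s) c x *: x).
Proof.
move=> /convex_setE cA; elim: s => [|y s IH] sA c0; first by rewrite big_nil ltxx.
have sA' x : x \in s -> A x by move=> xs; apply: sA; rewrite inE xs orbT.
have c0' x : x \in s -> 0 <= c x by move=> xs; apply: c0; rewrite inE xs orbT.
have Ay : A y by apply: sA; rewrite inE eqxx.
have cy : 0 <= c y by apply: c0; rewrite inE eqxx.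
rewrite !big_cons; have : 0 <= \sum_(x <- s) c x by rewrite big_seq sumr_ge0.
(* The induction hypothesis needs a positive tail weight. If that weight is 0, every tail
   coefficient vanishes and only [y] remains. *)
rewrite le_eqVlt => /orP[/eqP s0|sgt0 tot].
  have -> : \sum_(x <- s) c x *: x = 0.
    rewrite big_seq big1// => x xs; suff -> : c x = 0 by rewrite scale0r.
    apply/eqP; move/esym/eqP: s0; rewrite big_seq psumr_eq0; last first.
      by move=> i; apply: c0'.
    by move=> /allP/(_ x xs); rewrite xs.
  rewrite -s0 !addr0 => cy0; rewrite scalerA mulVf ?scale1r//.
  by rewrite gt_eqF.
set S := \sum_(x <- s) c x in sgt0 tot IH *.
have -> : (c y + S)^-1 *: (c y *: y + \sum_(x <- s) c x *: x) =
    (c y / (c y + S)) *: y +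
    (1 - c y / (c y + S)) *: (S^-1 *: \sum_(x <- s) c x *: x).
  rewrite scalerDr !scalerA [_ * c y]mulrC; congr (_ + _ *: _).
  rewrite -[X in X - _](mulfV (lt0r_neq0 tot)) -mulrBl addrAC subrr add0r.
  by rewrite mulrAC mulfV ?mul1r// gt_eqF.
apply: cA => //; last exact: IH.
by rewrite divr_ge0 ?(ltW tot)//= ler_pdivrMr// mul1r lerDl ltW.
Qed.

(** * Finite sets of prescribed size *)

Lemma fset_subset_card (T : choiceType) (A : {fset T}) (m : nat) :
  (m <= #|` A|)%N -> exists2 B : {fset T}, B `<=` A & #|` B| = m.
Proof.
move=> mA; exists [fset x in take m A].
  by apply/fsubsetP => x; rewrite !inE => /mem_take.
by rewrite card_fseq undup_id ?take_uniq// size_take_min; apply/minn_idPl.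
Qed.

Lemma fset_between_card (T : choiceType) (A B : {fset T}) (m : nat) :
  A `<=` B -> (#|` A| <= m <= #|` B|)%N ->
  exists C : {fset T}, [/\ A `<=` C, C `<=` B & #|` C| = m].
Proof.
move=> AB /andP[Am mB].
have [|D DBA cD] := @fset_subset_card T (B `\` A) (m - #|` A|)%N.
  by rewrite cardfsDS// leq_sub2r.
exists (A `|` D); split; first exact: fsubsetUl.
  by rewrite fsubUset AB (fsubset_trans DBA)// fsubsetDl.
rewrite cardfsU (_ : A `&` D = fset0) ?cardfs0 ?subn0 ?cD ?subnKC//.
apply/fsetP => x; rewrite !inE; apply/negbTE/negP => /andP[xA xD].
by move: (fsubsetP DBA _ xD); rewrite !inE xA.
Qed.

(** * Affine dependences and planes through given points *)

Lemma row_kernel_neq0 (F : fieldType) (m n : nat) (A : 'M[F]_(m, n)) :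
  (n < m)%N -> exists2 v : 'rV_m, v != 0 & v *m A = 0.
Proof.
move=> nm; have : kermx A != 0.
  rewrite -mxrank_eq0 mxrank_ker -lt0n subn_gt0.
  exact: leq_ltn_trans (rank_leq_col A) nm.
by case/rowV0Pn => v /sub_kermxP vA v0; exists v.
Qed.

(** Appending a coordinate 1 to each point gives more than d + 1 vectors in dimension d + 1; the
    last coordinate of a linear dependence among them says that its coefficients sum to 0. *)
Lemma affine_dependence (F : fieldType) (d : nat) (Z : {fset 'rV[F]_d}) :
  (d.+1 < #|` Z|)%N ->
  exists c : 'rV[F]_d -> F, [/\ exists2 x, x \in Z & c x != 0,
    \sum_(x <- Z) c x = 0 & \sum_(x <- Z) c x *: x = 0].
Proof.
move=> cZ.
pose A := \matrix_(i < size Z) row_mx (Z`_i) (1 : 'rV[F]_1).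
have [|v v0 vA] := @row_kernel_neq0 _ _ _ A; first by rewrite addn1.
(* [Z] lists no point twice, so this sum has at most one term: it reads the coefficient off the
   point. *)
pose c x := \sum_(i < size Z | Z`_i == x) v 0 i.
have cE (i : 'I_(size Z)) : c Z`_i = v 0 i.
  rewrite /c (big_pred1 i)// => j /=.
  by rewrite nth_uniq// ?fset_uniq.
have vA0 : \sum_(i < size Z) v 0 i *: row_mx Z`_i (1 : 'rV[F]_1) = 0.
  rewrite -[RHS]vA mulmx_sum_row; apply: eq_bigr => i _.
  by rewrite rowK.
exists c; split.
- have /rV0Pn[i vi0] := v0; exists Z`_i; last by rewrite cE.
  exact: mem_nth.
- rewrite (big_nth 0) big_mkord; move/(congr1 (fun u => rsubmx u 0 0)): vA0.
  rewrite linear_sum summxE linear0 mxE => h; rewrite -[RHS]h; apply: eq_bigr => i _.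
  by rewrite linearZ/= row_mxKr !mxE mulr1 cE.
- rewrite (big_nth 0) big_mkord; move/(congr1 lsubmx): vA0.
  rewrite linear_sum linear0 => h; rewrite -[RHS]h; apply: eq_bigr => i _.
  by rewrite linearZ/= row_mxKl cE.
Qed.

Lemma vspace_extend (F : fieldType) (V : vectType F) (U : {vspace V}) (r : nat) :
  (\dim U <= r <= \dim {:V})%N ->
  exists2 W : {vspace V}, (U <= W)%VS & \dim W = r.
Proof.
move=> /andP[Ur]; elim: r Ur => [|r IH] Ur rV.
  by exists U => //; apply/eqP; rewrite -leqn0.
move: Ur; rewrite leq_eqVlt => /predU1P[<-|]; first by exists U.
rewrite ltnS => /IH[|W UW dW]; first exact: ltnW.
have /subvPn[v _ vW] : ~~ ({:V} <= W)%VS.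
  by apply: contraL rV => /dimvS; rewrite dW -ltnNge.
exists (W + <[v]>)%VS; first exact: subv_trans UW (addvSl _ _).
have v0 : v != 0 by apply: contraNneq vW => ->; rewrite mem0v.
rewrite dimv_disjoint_sum ?dim_vline ?v0 ?dW ?addn1//.
apply/eqP; rewrite -subv0; apply/subvP => u; rewrite memv_cap => /andP[uW].
case/vlineP => a ua; move: uW; rewrite ua memv0.
by have [->|a0] := eqVneq a 0; rewrite ?scale0r ?eqxx// rpredZeq (negbTE a0) (negbTE vW).
Qed.

(** [Y] may be affinely dependent: the differences from one of its points span dimension at most r,
    and this span is then enlarged to dimension exactly r. *)
Lemma plane_through (F : fieldType) (d r : nat) (Y : {fset 'rV[F]_d}) :
  #|` Y| = r.+1 -> (r <= d)%N ->
  exists (p : 'rV[F]_d) (U : {vspace 'rV[F]_d}),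
    \dim U = r /\ forall y, y \in Y -> y - p \in U.
Proof.
move=> cY rd; have [p pY] : exists p, p \in Y.
  by apply/fset0Pn; rewrite -cardfs_gt0 cY.
have [|U sU dU] := @vspace_extend F _ <<[seq y - p | y <- Y `\ p]>>%VS r.
  rewrite dimvf /dim/= mul1n rd andbT (leq_trans (dim_span _))// size_map.
  by have := cardfsD1 p Y; rewrite cY pY => -[->].
exists p, U; split=> // y yY; have [->|yp] := eqVneq y p.
  by rewrite subrr mem0v.
by apply: (subvP sU); apply: memv_span; apply: map_f; rewrite !inE yp.
Qed.

(** * Lower bound: a Radon-type dependence and the transversal it gives *)

Lemma small_radon_dependence (R : realFieldType) (d : nat)
    (X : {fset 'rV[R]_d}) : (d.+1 < #|` X|)%N ->
  exists c : 'rV[R]_d -> R, [/\ exists2 b, b \in X & c b < 0,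
    \sum_(x <- X) c x = 0, \sum_(x <- X) c x *: x = 0 &
    (#|` [fset x in X | (0 < c x)%R]| <= d./2.+1)%N].
Proof.
move=> /fset_subset_card[Z ZX cZ].
have [|e [e_neq0 e0 ev0]] := @affine_dependence R d Z; first by rewrite cZ.
pose P := [fset x in Z | (0 < e x)%R]; pose N := [fset x in Z | (e x < 0)%R].
(* Replacing [e] by [- e] swaps [P] and [N], so [P] may be taken to be the smaller; it then has at
   most half of the d + 2 points. *)
wlog PN : e e_neq0 e0 ev0 @P @N / (#|` P| <= #|` N|)%N.
  move=> wl; have [/wl|NP] := leqP #|` P| #|` N|; first exact.
  have NE : [fset x in Z | (0 < - e x)%R] = N.
    by apply/fsetP => x; rewrite !inE oppr_gt0.
  have PE : [fset x in Z | (- e x < 0)%R] = P.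
    by apply/fsetP => x; rewrite !inE oppr_lt0.
  apply: (wl (fun x => - e x)); rewrite ?NE ?PE ?(ltnW NP)//.
  - by have [x xZ ex] := e_neq0; exists x; rewrite ?oppr_eq0.
  - by rewrite sumrN e0 oppr0.
  - by under eq_bigr do rewrite scaleNr; rewrite sumrN ev0 oppr0.
have cPN : (#|` P| + #|` N| <= d.+2)%N.
  rewrite -cZ -cardfsUI (_ : P `&` N = fset0) ?cardfs0 ?addn0.
    by apply/fsubset_leq_card/fsubsetP => x; rewrite !inE => /orP[]/andP[].
  apply/fsetP => x; rewrite !inE; apply/negP => /andP[/andP[_ h1] /andP[_ h2]].
  by have := lt_trans h1 h2; rewrite ltxx.
pose c x := if x \in Z then e x else 0.
have big_cE (V : zmodType) (F : R -> 'rV[R]_d -> V) :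
    (forall x, F 0 x = 0) ->
    \sum_(x <- X) F (c x) x = \sum_(x <- Z) F (e x) x.
  move=> F0; rewrite -(big_fset_incl _ ZX) => [|x _ xZ]; last first.
    by rewrite /c (negbTE xZ) F0.
  by rewrite !big_seq; apply: eq_bigr => x xZ; rewrite /c xZ.
exists c; split.
(* If [N] were empty, [e] would be nonnegative on [Z] with sum 0, hence zero there. *)
- have [N0|/fset0Pn[b]] := eqVneq N fset0; last first.
    rewrite !inE => /andP[bZ eb]; exists b; last by rewrite /c bZ.
    exact: (fsubsetP ZX).
  have [x xZ] := e_neq0; case/eqP.
  move/eqP: e0; rewrite big_seq psumr_eq0 => [/allP/(_ x xZ)|y yZ].
    by rewrite xZ => /eqP.
  rewrite leNgt; apply/negP => ey.
  by have := in_fset0 y; rewrite -N0 !inE yZ ey.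
- by rewrite (big_cE _ (fun a _ => a)).
- by rewrite (big_cE _ (fun a x => a *: x))// => x; rewrite scale0r.
- suff -> : [fset x in X | (0 < c x)%R] = P by lia.
  apply/fsetP => x; rewrite !inE /c; case: ifP => [xZ|]; last by rewrite ltxx andbF.
  by rewrite (fsubsetP ZX).
Qed.

Lemma plane_meets_hull (R : realType) (d : nat) (X Y : {fset 'rV[R]_d})
    (p : 'rV[R]_d) (U : {vspace 'rV[R]_d}) (c : 'rV[R]_d -> R) :
  Y `<=` X -> (forall y, y \in Y -> y - p \in U) ->
  \sum_(x <- X) c x = 0 -> \sum_(x <- X) c x *: x = 0 ->
  (forall x, x \in X `\` Y -> c x <= 0) ->
  (exists2 b, b \in X `\` Y & c b < 0) ->
  exists2 q, q - p \in U & convex_hull [set` (X `\` Y)%fset] q.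
Proof.
move=> YX YU c0 cv0 cle [b bXY cb].
have splitX (V : zmodType) (F : 'rV[R]_d -> V) :
    \sum_(x <- X) F x = \sum_(x <- Y) F x + \sum_(x <- X `\` Y) F x.
  rewrite (big_fsetID _ (mem Y)); congr (_ + _); apply: perm_big.
    apply: uniq_perm; rewrite ?fset_uniq// => x; rewrite !inE.
    by apply: andb_idl => /(fsubsetP YX).
  by apply: uniq_perm; rewrite ?fset_uniq// => x; rewrite !inE andbC.
have sgt0 : 0 < \sum_(x <- X `\` Y) - c x.
  rewrite lt_neqAle big_seq sumr_ge0 ?andbT => [|x xXY]; last first.
    by rewrite oppr_ge0 cle.
  rewrite eq_sym psumr_eq0 => [|x xXY]; last by rewrite oppr_ge0 cle.
  apply/negP => /allP/(_ b bXY); rewrite bXY/= oppr_eq0 => /eqP cb0.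
  by rewrite cb0 ltxx in cb.
exists ((\sum_(x <- X `\` Y) - c x)^-1 *: \sum_(x <- X `\` Y) - c x *: x); last first.
  move=> B [cB XYB]; apply: (convex_barycenter (M := 'rV[R]_d)) => //.
  by move=> x xXY; rewrite oppr_ge0 cle.
have sE : \sum_(x <- X `\` Y) - c x = \sum_(y <- Y) c y.
  rewrite sumrN; apply/esym/eqP; rewrite -addr_eq0; apply/eqP.
  by rewrite -splitX.
have vE : \sum_(x <- X `\` Y) - c x *: x = \sum_(y <- Y) c y *: y.
  under eq_bigr do rewrite scaleNr.
  rewrite sumrN; apply/esym/eqP; rewrite -addr_eq0; apply/eqP.
  by rewrite -splitX.
rewrite sE in sgt0 *; rewrite vE.
(* The coefficients on [Y] may have either sign; divided by their positive sum they form an affine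
   combination, so [p] can be subtracted term by term. *)
have -> : (\sum_(y <- Y) c y)^-1 *: (\sum_(y <- Y) c y *: y) - p =
    (\sum_(y <- Y) c y)^-1 *: \sum_(y <- Y) c y *: (y - p).
  rewrite [X in _ = _ *: X](eq_bigr (fun y => c y *: y - c y *: p)); last first.
    by move=> y _; rewrite scalerBr.
  rewrite sumrB -scaler_suml scalerBr [_ *: (_ *: p)]scalerA mulVf ?scale1r//.
  by rewrite gt_eqF.
by rewrite memvZ// big_seq memv_suml// => y yY; rewrite memvZ// YU.
Qed.

Lemma always_complete_transversal_lb (R : realType) (k d lambda : nat) :
  (0 < lambda <= d)%N -> (lambda < k)%N -> (lambda <= uphalf d)%N ->
  always_complete_transversal R k d lambda (d - lambda + 1 + k)%N.
Proof.
move=> /andP[l0 ld] lk lh; split=> [|X cX]; first by lia.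
have [|c [[b bX cb] c0 cv0 cP]] := @small_radon_dependence R d X.
  by rewrite cX; lia.
have [||Y [PY YXb cY]] := @fset_between_card _
    [fset x in X | (0 < c x)%R] (X `\ b) (d - lambda).+1.
- apply/fsubsetP => x; rewrite !inE => /andP[-> cx]; rewrite andbT.
  by apply: contraTneq cx => ->; rewrite -leNgt ltW.
- have cXb : #|` X `\ b| = (d - lambda + k)%N.
    by move: cX; rewrite (cardfsD1 b) bX add1n addn1 addSn => -[].
  (* With [lambda <= uphalf d] this gives [d./2 <= d - lambda], so [Y] has room for all positive
     points. *)
  have dE : (d = uphalf d + d./2)%N.
    by rewrite uphalf_half -addnA addnn odd_double_half.
  by rewrite cXb (leq_trans cP); lia.
have YX : Y `<=` X := fsubset_trans YXb (fsubsetDl _ _).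
have [|p [U [dU YU]]] := @plane_through _ d (d - lambda) Y cY.
  by rewrite leq_subr.
have cXY : #|` X `\` Y| = k by rewrite cardfsDS// cX cY; lia.
exists [set x | x - p \in U]%classic; split; last by exists Y.
split; first by exists p, U.
move=> K KX cK.
have [KY0|/fset0Pn[y]] := eqVneq (K `&` Y) fset0; last first.
  rewrite inE => /andP[yK yY]; exists y; split; first exact: YU.
  exact: sub_convex_hull.
(* [K] avoids [Y], and [X \ Y] has exactly k points. *)
have -> : K = X `\` Y.
  apply/eqP; rewrite eqEfcard cXY cK leqnn andbT.
  apply/fsubsetP => x xK; rewrite inE (fsubsetP KX)// andbT.
  by apply/negP => xY; have := in_fset0 x; rewrite -KY0 inE xK xY.
have [||q qU qXY] := @plane_meets_hull R d X Y p U c YX YU c0 cv0.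
- move=> x; rewrite inE => /andP[xY xX]; rewrite leNgt.
  by apply: contra xY => cx; apply: (fsubsetP PY); rewrite !inE xX.
- exists b => //; rewrite inE bX andbT; apply/negP => bY.
  by have := fsubsetP YXb _ bY; rewrite !inE eqxx.
- by exists q.
Qed.

(** * Upper bound: points on the moment curve *)

Definition moment_curve (R : pzSemiRingType) (d : nat) (t : R) : 'rV[R]_d :=
  \row_(j < d) t ^+ j.+1.

(** Along the curve the hyperplane equation is a nonzero polynomial in t of degree at most d, so it
    has at most d roots. *)
Lemma card_hyperplane_moment_curve (F : fieldType) (d : nat) (w : 'rV[F]_d)
    (a : F) (X : {fset 'rV[F]_d}) :
  w != 0 -> (forall x, x \in X -> exists t, x = moment_curve d t) ->
  (forall x, x \in X -> \sum_(j < d) x 0 j * w 0 j = a) -> (#|` X| <= d)%N.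
Proof.
case: d w X => [w|d w] X w0 Xcurve Xw; first by rewrite thinmx0 eqxx in w0.
have pw0 : rVpoly w != 0.
  by apply: contra_neq w0 => pw; rewrite -[w]rVpolyK pw linear0.
(* This is t * w(t) - a; the factor t matches the exponents [j.+1] of the curve. *)
pose q := cons_poly (- a) (rVpoly w).
have sq : size q = (size (rVpoly w)).+1.
  by rewrite /q size_cons_poly nil_poly (negbTE pw0).
have q0 : q != 0 by rewrite -size_poly_eq0 sq.
(* The first coordinate of a point of the curve is its parameter t, which determines the point. *)
pose s := [seq x 0 ord0 | x : 'rV_d.+1 <- X].
rewrite -[#|` X|](size_map (fun x : 'rV_d.+1 => x 0 ord0)) -/s.
suff : (size s < size q)%N.
  by rewrite sq ltnS => /leq_trans; apply; apply: size_poly.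
apply: max_poly_roots => //.
  apply/allP => _ /mapP[x xX ->]; rewrite rootE /q horner_cons.
  have [t xt] := Xcurve x xX; rewrite -(Xw x xX) subr_eq0 horner_poly big_distrl/=.
  apply/eqP/eq_bigr => j _; rewrite xt !mxE valK expr1 -mulrA -exprSr.
  by rewrite mulrC.
rewrite map_inj_in_uniq ?fset_uniq// => x y xX yX.
have [t ->] := Xcurve x xX; have [u ->] := Xcurve y yX.
by rewrite !mxE !expr1 => ->.
Qed.

(** The columns of [B] are a basis of [U]; being fewer than d, they leave a nonzero vector in the
    left kernel. *)
Lemma vspace_normal (F : fieldType) (d : nat) (U : {vspace 'rV[F]_d}) :
  (\dim U < d)%N ->
  exists2 w : 'rV[F]_d, w != 0 & forall u, u \in U -> \sum_j u 0 j * w 0 j = 0.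
Proof.
move=> Ud; pose B := \matrix_(i < d, j < \dim U) ((vbasis U)`_j) 0 i.
have [w w0 wB] := row_kernel_neq0 B Ud; exists w => // u uU.
rewrite (coord_vbasis uU).
under eq_bigr => j _ do rewrite summxE big_distrl/=.
rewrite exchange_big big1// => i _.
under eq_bigr => j _ do rewrite mxE -mulrA.
rewrite -big_distrr/=; have := congr1 (fun v : 'rV_ _ => v 0 i) wB.
rewrite !mxE => wBi; rewrite [X in _ * X](_ : _ = 0) ?mulr0// -[RHS]wBi.
by apply: eq_bigr => j _; rewrite mxE mulrC.
Qed.

Lemma convex_open_halfspace (R : realType) (d : nat) (w : 'rV[R]_d) (a : R) :
  convex_set ([set x | a < \sum_j x 0 j * w 0 j]%classic :
    set (convex_lmodType 'rV[R]_d)).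
Proof.
apply/convex_setE => x y t /andP[t0 t1] /= ax ay.
have -> : \sum_j (t *: x + (1 - t) *: y) 0 j * w 0 j =
    t * (\sum_j x 0 j * w 0 j) + (1 - t) * (\sum_j y 0 j * w 0 j).
  rewrite !big_distrr -big_split/=; apply: eq_bigr => j _.
  by rewrite !mxE mulrDl !mulrA.
(* For t > 0 the strict inequality comes from the [x] term; t = 0 leaves only [y]. *)
have [->|tneq0] := eqVneq t 0; first by rewrite mul0r add0r subr0 mul1r.
have -> : a = t * a + (1 - t) * a by rewrite -mulrDl addrC subrK mul1r.
apply: ltr_leD; first by rewrite ltr_pM2l// lt0r tneq0.
by rewrite ler_wpM2l ?subr_ge0// ltW.
Qed.

(** Pairing with [w] is constant on the plane, while the hull stays in the open half-space where the
    pairing exceeds that constant. *)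
Lemma plane_misses_hull (R : realType) (d : nat) (K : {fset 'rV[R]_d})
    (p w : 'rV[R]_d) (U : {vspace 'rV[R]_d}) :
  (forall u, u \in U -> \sum_j u 0 j * w 0 j = 0) ->
  (forall x, x \in K -> \sum_j p 0 j * w 0 j < \sum_j x 0 j * w 0 j) ->
  ~ ([set x | x - p \in U] `&` convex_hull [set` K] !=set0)%classic.
Proof.
move=> Uw Kw [q [/= /Uw qp]].
move=> /(convex_hull_subset (@convex_open_halfspace R d w (\sum_j p 0 j * w 0 j))).
move=> /(_ (fun x xK => Kw x xK))/=.
rewrite -subr_gt0 -sumrB [X in 0 < X](_ : _ = 0) ?ltxx// -[RHS]qp.
by apply: eq_bigr => j _; rewrite !mxE mulrBl.
Qed.

Lemma always_complete_transversal_ub (R : realType) (k d lambda n : nat) :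
  (0 < lambda <= d)%N ->
  always_complete_transversal R k d lambda n -> (n <= d + k.*2)%N.
Proof.
move=> /andP[l0 ld] [n0 nX]; rewrite leqNgt; apply/negP => dn.
pose s : seq 'rV[R]_d := [seq moment_curve d i%:R | i <- iota 0 n].
have us : uniq s.
  rewrite map_inj_in_uniq ?iota_uniq// => i j _ _.
  have d0 : (0 < d)%N by lia.
  move=> /(congr1 (fun v : 'rV[R]_d => v 0 (Ordinal d0))).
  by rewrite !mxE !expr1 => /eqP; rewrite eqr_nat => /eqP.
pose X := [fset x in s].
have cX : #|` X| = n by rewrite card_fseq undup_id// size_map size_iota.
have Xcurve x : x \in X -> exists t, x = moment_curve d t.
  by rewrite inE => /mapP[i _ ->]; exists i%:R.
have [L [[[p [U [dU ->]]] LK] _]] := nX X cX.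
have [|w w0 Uw] := @vspace_normal _ d U; first by rewrite dU; lia.
pose f (w x : 'rV[R]_d) := \sum_j x 0 j * w 0 j.
have fN v x : f (- v) x = - f v x.
  by rewrite /f -sumrN; apply: eq_bigr => j _; rewrite mxE mulrN.
(* Otherwise k points strictly on one side of the hyperplane would have a hull missing the
   transversal. Used for [w] and [- w], this bounds both sides. *)
have few v : (forall u, u \in U -> f v u = 0) ->
    (#|` [fset x in X | (f v p < f v x)%R]| < k)%N.
  move=> Uv; rewrite ltnNge; apply/negP => /fset_subset_card[K KX cK].
  apply: (@plane_misses_hull R d K p v U Uv).
    by move=> x xK; have := fsubsetP KX _ xK; rewrite !inE => /andP[].
  by apply: LK => //; apply: fsubset_trans KX _; apply: fset_sub.
have := few w Uw; have := few (- w).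
have /[swap] /[apply] : forall u, u \in U -> f (- w) u = 0.
  by move=> u /Uw fu; rewrite fN /f fu oppr0.
set N := [fset x in X | _]; set P := [fset x in X | _] => cN cP.
pose Z := [fset x in X | f w x == f w p].
have cZ : (#|` Z| <= d)%N.
  apply: (@card_hyperplane_moment_curve _ d w (f w p)) => // x.
    by rewrite inE => /andP[/Xcurve].
  by rewrite inE => /andP[_ /eqP].
have : (#|` X| <= #|` Z `|` (P `|` N)|)%N.
  apply/fsubset_leq_card/fsubsetP => x; rewrite !inE => ->/=; rewrite !fN ltrN2.
  by case: ltgtP.
(* At most d points lie on the hyperplane and fewer than k on each side, against n > d + 2k. *)
rewrite cX !cardfsU; lia.
Qed.

(** * Existence of the maximum and conclusion *)

Lemma nat_bounded_max (S : set nat) (n b : nat) :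
  S n -> (forall m, S m -> (m <= b)%N) -> exists m, (S `&` ubound S)%classic m.
Proof.
move=> Sn Sb; have exS : exists m, `[< S m >] by exists n; apply/asboolP.
have ubS m : `[< S m >] -> (m <= b)%N by move=> /asboolP/Sb.
case: (ex_maxnP exS ubS) => m /asboolP Sm mmax; exists m; split=> // i /asboolP.
exact: mmax.
Qed.

Theorem theorem1 (R : realType) (k d lambda : nat)
    (k_gt0 : (0 < k)%N) (d_gt0 : (0 < d)%N) (lambda_gt0 : (0 < lambda)%N)
    (le_lambda_d : (lambda <= d)%N) (le_lambda_k : (lambda + 1 <= k)%N)
    (alpha_lt1 : (alpha d lambda < 1)%R) :
  ((d - lambda + 1) + k <= mstar R k d lambda)%N.
Proof.
have ld : (0 < lambda <= d)%N by rewrite lambda_gt0.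
(* Clearing the denominator of [alpha] gives lambda - 1 < [uphalf d]. *)
have lh : (lambda <= uphalf d)%N.
  have h0 : (0 < uphalf d)%N by lia.
  move: alpha_lt1; rewrite /alpha ltr_pdivrMr ?ltr0n// mul1r.
  by rewrite ltrBlDr natr1 ltr_nat.
have Sn : always_complete_transversal R k d lambda (d - lambda + 1 + k)%N.
  by apply: always_complete_transversal_lb; lia.
have [m Sm] := nat_bounded_max Sn
  (fun m Sm => always_complete_transversal_ub ld Sm).
(* Since a maximum exists, [xget] returns it and not the default 0; as an upper bound it dominates
   the element given by [Sn]. *)
by have [_] := @xgetPex _ 0%N _ (ex_intro _ m Sm); apply.
Qed.
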